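(* Let $F\in L^\infty\setminus\{0\}$ and let $u\in H^2$ be outer, such that $\ker T_F\neq\{0\}$ and $u\ker T_F\subseteq H^2$. If $u^{-1}\in H^\infty$, then $$u\ker T_F=\ker T_{F\overline{u}/u}=\ker T_{F/u}.$$
   Context: $\mathbb{T}$ is the unit circle with normalized Lebesgue measure, $L^\infty=L^\infty(\mathbb{T})$, $H^2$ is the Hardy space of the unit disc, regarded as a closed subspace of $L^2(\mathbb{T})$ via boundary values, $H^\infty$ is the algebra of bounded analytic functions on the disc, and $P_{H^2}:L^2(\mathbb{T})\to H^2$ is the orthogonal projection. For $g\in L^\infty$ the Toeplitz operator is $T_g:H^2\to H^2$, $T_gf=P_{H^2}(gf)$. *)

(* Defs.v *)
From HB Require Import structures.
From mathcomp Require Import all_boot all_order all_algebra.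
From mathcomp Require Import all_classical all_reals all_analysis.
From mathcomp Require Import complex.

Set Implicit Arguments.
Unset Strict Implicit.
Unset Printing Implicit Defensive.

Import Order.TTheory GRing.Theory Num.Theory.
Import numFieldNormedType.Exports.

Local Open Scope classical_set_scope.
Local Open Scope complex_scope.
Local Open Scope ring_scope.

Section Circle.
Variable R : realType.
Local Notation C := R[i].

Definition cmod (z : C) : R := complex.Re `|z|.

Definition expi (t : R) : C := cos t +i* sin t.

Definition cexp (w : C) : C := (expR (complex.Re w))%:C * expi (complex.Im w).

Lemma two_pi_gt0 : 0 < 2 * pi :> R.
Proof. by rewrite mulr_gt0 // pi_gt0. Qed.

(* A function on the unit circle is a function of the angle t, the point being
   [expi t].  Only the values for t in [0, 2 pi] matter: the normalized Lebesgue
   measure is the uniform probability on that interval. *)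
Definition circ : probability _ R := uniform_prob two_pi_gt0.

Definition cmeasurable (f : R -> C) : Prop :=
  @measurable_fun _ _ (measurableTypeR R) R setT (fun t => complex.Re (f t)) /\
  @measurable_fun _ _ (measurableTypeR R) R setT (fun t => complex.Im (f t)).

Definition cintegral (f : R -> C) : C :=
  (\int[circ]_t complex.Re (f t)) +i* (\int[circ]_t complex.Im (f t)).

(* Elements of L^p are represented by functions.  Every set of functions below
   is stable under modifying its (measurable) elements on a null set, so that an
   equality of two such sets is the equality of the sets of a.e. classes. *)
Definition aeq (f g : R -> C) : Prop := ae_eq circ setT f g.

Definition Lp (p : \bar R) : set (R -> C) :=
  [set f | cmeasurable f /\
           ('N[circ]_p [(fun t => (cmod (f t))%:E)] < +oo)%E].

Definition inner (f g : R -> C) : C := cintegral (fun t => f t * (g t)^*).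

(* An analytic function on the disc is the sum of a power series centred at 0;
   the values of U outside the open disc are irrelevant. *)
Definition analytic_disc (U : C -> C) : Prop :=
  exists a : nat -> C, forall z : C, `|z| < 1 ->
    (series (fun k => a k * z ^+ k) : nat -> C^o) @ \oo --> (U z : C^o).

Definition hardy2_disc (U : C -> C) : Prop :=
  analytic_disc U /\
  exists M : R, forall r : R, 0 <= r < 1 ->
    ('N[circ]_2%:E [(fun t => (cmod (U (r%:C * expi t)))%:E)] <= M%:E)%E.

Definition hardyoo_disc (U : C -> C) : Prop :=
  analytic_disc U /\ exists M : R, forall z : C, `|z| < 1 -> cmod (U z) <= M.

Definition boundary_values (U : C -> C) (f : R -> C) : Prop :=
  {ae circ, forall t, (U (r%:C * expi t) : C^o) @[r --> (1 : R)^'-]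
                        --> (f t : C^o)}.

Definition H2 : set (R -> C) :=
  [set f | Lp 2%:E f /\ exists2 U, hardy2_disc U & boundary_values U f].

Definition Hoo : set (R -> C) :=
  [set f | Lp +oo%E f /\ exists2 U, hardyoo_disc U & boundary_values U f].

(* Here phi is then |U| on the boundary, a.e. *)
Definition outer_disc (U : C -> C) : Prop :=
  exists (alpha : C) (phi : R -> R),
    [/\ `|alpha| = 1,
        @measurable_fun _ _ (measurableTypeR R) R setT phi,
        forall t, 0 < phi t,
        circ.-integrable setT (fun t => (ln (phi t))%:E) &
        forall z : C, `|z| < 1 ->
          U z = alpha * cexp (cintegral (fun t =>
                  (expi t + z) / (expi t - z) * (ln (phi t))%:C))].

Definition outer (u : R -> C) : Prop :=
  exists U, [/\ hardy2_disc U, boundary_values U u & outer_disc U].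

Definition orth_proj (E : set (R -> C)) (f p : R -> C) : Prop :=
  E p /\ forall h, E h -> inner (f \- p) h = 0.

(* Graph of the Toeplitz operator: T_g f = p up to a null set.  The symbol has
   to be in L^oo, so that the kernel is empty when T_g is not defined. *)
Definition toeplitz (g f p : R -> C) : Prop :=
  [/\ Lp +oo%E g, H2 f & orth_proj H2 (g \* f) p].

Definition kerT (g : R -> C) : set (R -> C) :=
  [set f | toeplitz g f (fun=> 0)].

Definition mul_set (u : R -> C) (S : set (R -> C)) : set (R -> C) :=
  [set g | cmeasurable g /\ exists2 f, S f & aeq g (u \* f)].

End Circle.

(* Main.v *)
(* Put v = 1/u.  For f in H^2, the radial restrictions f_r are bounded in L^2 and
   tend to f a.e., hence weakly in L^2; so a function orthogonal to all the
   monomials is orthogonal to H^2, and boundary values determine the Taylor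
   coefficients.  If f is in ker T_F and g = u f, then
     <F ubar/u g, z^n> = <F ubar f, z^n> = <F f, u z^n> = 0
   since u z^n is in H^2, although u h need not be for a general h in H^2;
   moreover F/u g = F f.  Conversely, if g is in the kernel for F ubar/u, then
   f = v g is in H^2 and <F f, h> = <F ubar/u g, v h> = 0 for h in H^2; for F/u,
   directly F f = F/u g.
   These computations need u <> 0 a.e., which is not automatic because 0^-1 = 0;
   it is deduced from the formal power series of u and v. *)
Require Import Defs.
From HB Require Import structures.
From mathcomp Require Import all_boot all_order all_algebra.
From mathcomp Require Import all_classical all_reals all_analysis.
From mathcomp Require Import measurable_realfun ess_sup_inf complex.
From mathcomp Require Import ring lra.
Import Order.TTheory GRing.Theory Num.Theory.
Import numFieldNormedType.Exports.
Local Open Scope classical_set_scope.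
Local Open Scope complex_scope.
Local Open Scope ring_scope.
Set Implicit Arguments.
Unset Strict Implicit.
Unset Printing Implicit Defensive.

(** Membership in a Toeplitz kernel amounts to orthogonality of a product to H^2, so each inclusion
    is an identity between pairings; the work lies in the facts on H^2 that make the test functions
    admissible. The definition of H^2 provides just a power series, a bound on circles and radial
    limits a.e. Weak convergence is therefore proved directly, against one fixed L^2 function at a
    time, without Parseval's identity or completeness of H^2. That [u] vanishes only on a null set
    would classically come from the integrability of log |u|. Here an identity of boundary values is
    transferred to Taylor coefficients, where it becomes a cancellation in the ring of formal power
    series. Cauchy products are developed for this purpose, and to show that a product of an H^oo
    and an H^2 function is analytic. *)

(** * The real-valued modulus, and complex limits in real terms *)

Section Modulus.
Variable R : realType.
Local Notation C := R[i].
Implicit Types (z w : C).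

Lemma normC_cmod z : `|z| = (cmod z)%:C.
Proof. by rewrite /cmod normc_def. Qed.

Lemma cmod_sqr z : cmod z ^+ 2 = complex.Re z ^+ 2 + complex.Im z ^+ 2.
Proof.
by rewrite /cmod normc_def /= sqr_sqrtr // addr_ge0 // sqr_ge0.
Qed.

Lemma cmod_ge0 z : 0 <= cmod z.
Proof. by rewrite /cmod normc_def /= sqrtr_ge0. Qed.

Lemma cmodM z w : cmod (z * w) = cmod z * cmod w.
Proof. by apply: complexI; rewrite rmorphM /= -!normC_cmod normrM. Qed.

Lemma cmodX z n : cmod (z ^+ n) = cmod z ^+ n.
Proof. by apply: complexI; rewrite rmorphXn /= -!normC_cmod normrX. Qed.

Lemma cmodD z w : cmod (z + w) <= cmod z + cmod w.
Proof. by rewrite -lecR rmorphD /= -!normC_cmod ler_normD. Qed.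

Lemma cmodN z : cmod (- z) = cmod z.
Proof. by apply: complexI; rewrite -!normC_cmod normrN. Qed.

Lemma cmodJ z : cmod z^* = cmod z.
Proof. by apply: complexI; rewrite -!normC_cmod normcJ. Qed.

Lemma cmod_real (r : R) : cmod r%:C = `|r|.
Proof. by rewrite /cmod normc_def /= expr0n /= addr0 sqrtr_sqr. Qed.

Lemma cmod0 : cmod (0 : C) = 0.
Proof. by rewrite (_ : 0 = 0%:C) // cmod_real normr0. Qed.

Lemma cmod1 : cmod (1 : C) = 1.
Proof. by rewrite (_ : 1 = 1%:C) // cmod_real normr1. Qed.

Lemma cmod_eq0 z : (cmod z == 0) = (z == 0).
Proof. by rewrite -(inj_eq (@complexI R)) -normC_cmod normr_eq0. Qed.

Lemma cmod_lt z (r : R) : (`|z| < r%:C) = (cmod z < r).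
Proof. by rewrite normC_cmod ltcR. Qed.

Lemma Re_le_cmod z : `|complex.Re z| <= cmod z.
Proof.
rewrite -(@ler_sqr R) ?nnegrE ?cmod_ge0// real_normK ?num_real// cmod_sqr.
by rewrite lerDl sqr_ge0.
Qed.

Lemma Im_le_cmod z : `|complex.Im z| <= cmod z.
Proof.
rewrite -(@ler_sqr R) ?nnegrE ?cmod_ge0// real_normK ?num_real// cmod_sqr.
by rewrite lerDr sqr_ge0.
Qed.

Lemma cmod_le_ReIm z : cmod z <= `|complex.Re z| + `|complex.Im z|.
Proof.
rewrite -(@ler_sqr R) ?nnegrE ?cmod_ge0 ?addr_ge0// cmod_sqr.
rewrite -[complex.Re z ^+ 2]real_normK ?num_real//.
rewrite -[complex.Im z ^+ 2]real_normK ?num_real//.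
by rewrite sqrrD lerD2r lerDl mulrn_wge0 // mulr_ge0.
Qed.

Lemma cmod_sum I (r : seq I) (P : pred I) (F : I -> C) :
  cmod (\sum_(i <- r | P i) F i) <= \sum_(i <- r | P i) cmod (F i).
Proof.
elim/big_rec2: _ => [|i x y _ xy]; first by rewrite cmod0.
by rewrite (le_trans (cmodD _ _)) // lerD2l.
Qed.

(** The norm of [C] takes its values in [C] itself; going over to the real [cmod] gives access to
    squeezing and to the order of [R]. *)
Lemma cvgC_cmod (T : Type) (F : set_system T) {FF : Filter F} (f : T -> C) (l : C) :
  (f @ F --> (l : C^o)) <-> (cmod (f x - l) @[x --> F] --> 0).
Proof.
split => [h|/cvgrPdist_lt h].
  have {}h := (@cvgrPdist_lt C C^o T F FF f l).1 h.
  apply/cvgrPdist_lt => e e0; have := h e%:C; rewrite ltcR => /(_ e0).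
  apply: filterS => x /=.
  by rewrite distrC cmod_lt sub0r normrN (ger0_norm (cmod_ge0 _)).
(* A positive element of [C] has zero imaginary part, so this epsilon is real. *)
apply/(@cvgrPdist_lt C C^o T F FF f l) => -[e e'] /=; rewrite ltcE /= => /andP[/eqP -> e0].
apply: filterS (h e e0) => x /=.
by rewrite sub0r normrN (ger0_norm (cmod_ge0 _)) distrC (cmod_lt _ e).
Qed.

Lemma cvgC_ReIm (T : Type) (F : set_system T) {FF : Filter F} (f : T -> C) (l : C) :
  (f @ F --> (l : C^o)) <->
  (complex.Re (f x) @[x --> F] --> complex.Re l /\
   complex.Im (f x) @[x --> F] --> complex.Im l).
Proof.
rewrite cvgC_cmod; split => [h|[hr hi]].
  move/cvgrPdist_lt : h => h.
  split; apply/cvgrPdist_lt => e e0; apply: filterS (h e e0) => x; rewrite sub0r normrN (ger0_norm (cmod_ge0 _)); apply: le_lt_trans;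
    rewrite distrC.
  - by have := Re_le_cmod (f x - l); case: (f x) (l) => [? ?] [? ?].
  - by have := Im_le_cmod (f x - l); case: (f x) (l) => [? ?] [? ?].
have : `|complex.Re (f x) - complex.Re l| + `|complex.Im (f x) - complex.Im l|
    @[x --> F] --> 0.
  rewrite -[0 in X in _ --> X](addr0 0); apply: cvgD.
    by apply/norm_cvg0P/subr_cvg0.
  by apply/norm_cvg0P/subr_cvg0.
apply: (squeeze_cvgr _ (cvg_cst 0)); apply: nearW => x; rewrite cmod_ge0 /=.
by have := cmod_le_ReIm (f x - l); case: (f x) (l) => [? ?] [? ?].
Qed.

End Modulus.

(** * L^2-bounded sequences that tend to 0 almost everywhere *)

Section BoundedL2.
Context d (T : measurableType d) (R : realType).
Variable mu : {measure set T -> \bar R}.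
Implicit Types (k : T -> R) (D : nat -> T -> R).

(* [k D <= k min(D, k/c) + c D^2]: the first term tends to 0 by dominated
   convergence (it is at most [k^2/c]), the second one has a small integral. *)
Lemma integral_mul_near0 k D (M : R) :
  measurable_fun setT k -> (forall n, measurable_fun setT (D n)) ->
  (forall x, 0 <= k x) -> (forall n x, 0 <= D n x) ->
  mu.-integrable setT (fun x => (k x ^+ 2)%:E) ->
  (forall n, (\int[mu]_x (D n x ^+ 2)%:E <= M%:E)%E) ->
  {ae mu, forall x, D n x @[n --> \oo] --> 0} ->
  forall e : R, 0 < e ->
    \forall n \near \oo, (\int[mu]_x (k x * D n x)%:E < e%:E)%E.
Proof.
move=> mk mD k0 D0 ik DM Dcvg e e0.
have M0 : 0 <= M.
  by rewrite -lee_fin (le_trans _ (DM 0)) // integral_ge0 // => x _; rewrite lee_fin sqr_ge0.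
(* Chosen so that the term [c * D^2] contributes at most [c * M < e / 2]; [M + 1] replaces [M]
   because [M] may be 0. *)
pose c : R := e / (2 * (M + 1)).
have c0 : 0 < c by rewrite divr_gt0 // mulr_gt0 // ltr_wpDl.
have cM : c * M < e / 2.
  rewrite /c invfM mulrA -mulrA gtr_pMr ?divr_gt0 //.
  by rewrite mulrC ltr_pdivrMr ?ltr_wpDl // mul1r ltrDl.
pose g n x : R := k x * Num.min (D n x) (k x / c).
have mg n : measurable_fun setT (g n).
  apply: measurable_funM => //; apply: measurable_minr => //.
  by apply: measurable_funM => //; exact: measurable_cst.
have g0 n x : 0 <= g n x.
  by rewrite mulr_ge0 // le_min D0 /= divr_ge0 // ltW.
(* Where the minimum is not [D], one has [k < c * D], and the second term alone suffices. *)
have kDE n x : k x * D n x <= g n x + c * D n x ^+ 2.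
  rewrite /g; have [h|h] := leP (D n x) (k x / c).
    by rewrite lerDl mulr_ge0 ?sqr_ge0 // ltW.
  have : k x <= c * D n x by rewrite mulrC -ler_pdivrMr // ltW.
  move=> h'; have := ler_wpM2r (D0 n x) h'; rewrite -mulrA -expr2 => h2.
  by rewrite (le_trans h2) // lerDr mulr_ge0 // divr_ge0 // ltW.
have [_ _] : [/\ mu.-integrable setT (fun=> 0%E : \bar R),
    [sequence \int[mu]_x `|(g n x)%:E - 0|]_n%E @ \oo --> 0%E &
    [sequence \int[mu]_x (g n x)%:E]_n%E @ \oo --> (\int[mu]_x 0)%E].
  apply: (@dominated_convergence _ _ _ mu setT measurableT
    (fun n x => (g n x)%:E) _ (fun x => (c^-1 * k x ^+ 2)%:E)).
  - by move=> n; apply/measurable_EFinP.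
  - exact: measurable_cst.
  - apply: filterS Dcvg => x Dx _; apply/cvg_EFin; first exact: nearW.
    have kD0 : k x * D n x @[n --> \oo] --> 0.
      rewrite -[0 in X in _ --> X](mulr0 (k x)); exact: cvgMr.
    apply: (squeeze_cvgr _ (cvg_cst 0) kD0); apply: nearW => n.
    by rewrite g0 /= ler_wpM2l // ge_min lexx.
  - by under eq_fun do rewrite EFinM; apply: integrableZl.
  - apply: aeW => x n _; rewrite gee0_abs ?lee_fin //.
    rewrite /g expr2 mulrCA ler_wpM2l // ge_min; apply/orP; right.
    by rewrite mulrC.
rewrite integral0 => /fine_cvgP[_ /cvgrPdist_lt/(_ (e/2))].
rewrite divr_gt0 // => /(_ isT); apply: filterS => n /=.
rewrite sub0r normrN => hn.
have gk : mu.-integrable setT (fun x => (g n x)%:E).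
  apply: (@le_integrable _ _ _ mu setT measurableT _ (fun x => (c^-1 * k x ^+ 2)%:E)).
  - exact/measurable_EFinP.
  - move=> x _; rewrite !gee0_abs ?lee_fin // ?mulr_ge0 ?invr_ge0 ?sqr_ge0 ?(ltW c0)//.
    rewrite /g expr2 mulrCA ler_wpM2l // ge_min; apply/orP; right.
    by rewrite mulrC.
  - by under eq_fun do rewrite EFinM; apply: integrableZl.
have fg := integrable_fin_num measurableT gk.
have mD2 : measurable_fun setT (fun x => (D n x ^+ 2)%:E).
  by apply/measurable_EFinP; exact: measurable_funX.
apply: (@le_lt_trans _ _ (\int[mu]_x ((g n x)%:E + c%:E * (D n x ^+ 2)%:E))%E).
  apply: ge0_le_integral => //.
  - by move=> x _; rewrite lee_fin mulr_ge0.
  - by apply/measurable_EFinP; exact: measurable_funM.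
  - apply/measurable_EFinP; apply: measurable_funD => //; apply: measurable_funM => //.
    exact: measurable_funX.
  - by move=> x _; rewrite lee_fin kDE.
rewrite ge0_integralD //; last 4 first.
  - by move=> x _; rewrite lee_fin.
  - exact/measurable_EFinP.
  - by move=> x _; rewrite lee_fin mulr_ge0 ?sqr_ge0 // ltW.
  - by apply: measurable_funeM.
rewrite ge0_integralZl //; last 2 first.
  - by move=> x _; rewrite lee_fin sqr_ge0.
  - by rewrite lee_fin ltW.
rewrite -(fineK fg) (@le_lt_trans _ _ ((fine (\int[mu]_x (g n x)%:E))%:E + c%:E * M%:E)%E) //.
  by rewrite leeD2l // lee_wpmul2l // lee_fin ltW.
rewrite -EFinM -EFinD lte_fin; have := ler_norm (fine (\int[mu]_x (g n x)%:E)).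
lra.
Qed.

End BoundedL2.

(** * Integration of complex functions on the circle *)

Section CircleIntegral.
Variable R : realType.
Local Notation C := R[i].
Local Notation mu := (circ R).
Implicit Types (f g h k : R -> C).

Lemma ae_circS (P Q : R -> Prop) : (forall t, P t -> Q t) ->
  {ae mu, forall t, P t} -> {ae mu, forall t, Q t}.
Proof. exact: (@filterS _ _ (ae_filter_ringOfSetsType mu) P Q). Qed.

Lemma ae_circS2 (P Q S : R -> Prop) : (forall t, P t -> Q t -> S t) ->
  {ae mu, forall t, P t} -> {ae mu, forall t, Q t} -> {ae mu, forall t, S t}.
Proof. exact: (@filterS2 _ _ (ae_filter_ringOfSetsType mu) P Q S). Qed.

Lemma ReM (z w : C) : complex.Re (z * w) =
  complex.Re z * complex.Re w - complex.Im z * complex.Im w.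
Proof. by case: z w => [? ?] [? ?]. Qed.

Lemma ImM (z w : C) : complex.Im (z * w) =
  complex.Re z * complex.Im w + complex.Im z * complex.Re w.
Proof. by case: z w => [? ?] [? ?]. Qed.

Lemma ReD (z w : C) : complex.Re (z + w) = complex.Re z + complex.Re w.
Proof. by case: z w => [? ?] [? ?]. Qed.

Lemma ImD (z w : C) : complex.Im (z + w) = complex.Im z + complex.Im w.
Proof. by case: z w => [? ?] [? ?]. Qed.

Lemma cmeasurable_cst (c : C) : cmeasurable (fun=> c).
Proof. by split; exact: measurable_cst. Qed.

Lemma cmeasurableD f g : cmeasurable f -> cmeasurable g -> cmeasurable (f \+ g).
Proof.
move=> [f1 f2] [g1 g2]; split => /=.
  by under eq_fun do rewrite ReD; exact: measurable_funD.
by under eq_fun do rewrite ImD; exact: measurable_funD.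
Qed.

Lemma cmeasurableM f g : cmeasurable f -> cmeasurable g -> cmeasurable (f \* g).
Proof.
move=> [f1 f2] [g1 g2]; split => /=.
  by under eq_fun do rewrite ReM; apply: measurable_funB; exact: measurable_funM.
by under eq_fun do rewrite ImM; apply: measurable_funD; exact: measurable_funM.
Qed.

Lemma cmeasurableN f : cmeasurable f -> cmeasurable (\- f).
Proof.
move=> mf; rewrite (_ : \- f = (fun=> -1) \* f).
  by apply: cmeasurableM => //; exact: cmeasurable_cst.
by apply/funext => t /=; rewrite mulN1r.
Qed.

Lemma cmeasurableB f g : cmeasurable f -> cmeasurable g -> cmeasurable (f \- g).
Proof. by move=> mf mg; apply: cmeasurableD => //; exact: cmeasurableN. Qed.

Lemma cmeasurableJ f : cmeasurable f -> cmeasurable (fun t => (f t)^*).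
Proof.
move=> [f1 f2]; split.
  by rewrite [X in measurable_fun _ X](_ : _ = @complex.Re R \o f) //;
    apply/funext => t /=; case: (f t).
rewrite [X in measurable_fun _ X](_ : _ = \- (@complex.Im R \o f)).
  exact: measurableT_comp.
by apply/funext => t /=; case: (f t).
Qed.

Lemma cmeasurable_sum (I : Type) (r : seq I) (F : I -> R -> C) :
  (forall i, cmeasurable (F i)) -> cmeasurable (fun t => \sum_(i <- r) F i t).
Proof.
move=> mF; elim: r => [|i r IH].
  by under eq_fun do rewrite big_nil; exact: cmeasurable_cst.
by under eq_fun do rewrite big_cons; exact: (cmeasurableD (mF i) IH).
Qed.

Lemma cmeasurable_cvg (F : nat -> R -> C) f : (forall n, cmeasurable (F n)) ->
  (forall t, F n t @[n --> \oo] --> (f t : C^o)) -> cmeasurable f.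
Proof.
move=> mF cF; split.
  apply: (@measurable_fun_cvg _ (measurableTypeR R) R setT
    (fun n t => complex.Re (F n t))) => [n|t _]; first by case: (mF n).
  by have /cvgC_ReIm[] := cF t.
apply: (@measurable_fun_cvg _ (measurableTypeR R) R setT
    (fun n t => complex.Im (F n t))) => [n|t _]; first by case: (mF n).
by have /cvgC_ReIm[] := cF t.
Qed.

Lemma measurable_cmod f : cmeasurable f ->
  @measurable_fun _ _ (measurableTypeR R) R setT (fun t => cmod (f t)).
Proof.
move=> [f1 f2]; rewrite /cmod.
under eq_fun do rewrite normc_def /=.
apply: (@measurableT_comp _ _ _ _ _ _ (@Num.sqrt R)).
  by apply: continuous_measurable_fun => x; exact: sqrt_continuous.
by apply: measurable_funD; exact: measurable_funX.
Qed.

Definition cintegrable f := cmeasurable f /\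
  mu.-integrable setT (fun t => (cmod (f t))%:E).

Lemma cintegrable_le f (g : R -> R) : cmeasurable f ->
  mu.-integrable setT (EFin \o g) -> (forall t, cmod (f t) <= g t) ->
  cintegrable f.
Proof.
move=> mf ig fg; split => //; apply: le_integrable ig => //.
  by apply/measurable_EFinP; exact: measurable_cmod.
by move=> t _ /=; rewrite lee_fin (ger0_norm (cmod_ge0 _)) (le_trans (fg t)) // ler_norm.
Qed.

Lemma integrable_Re f : cintegrable f -> mu.-integrable setT (EFin \o (@complex.Re R \o f)).
Proof.
move=> [[f1 f2] fi]; apply: le_integrable fi => //; first exact/measurable_EFinP.
by move=> t _ /=; rewrite lee_fin (ger0_norm (cmod_ge0 _)) Re_le_cmod.
Qed.

Lemma integrable_Im f : cintegrable f -> mu.-integrable setT (EFin \o (@complex.Im R \o f)).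
Proof.
move=> [[f1 f2] fi]; apply: le_integrable fi => //; first exact/measurable_EFinP.
by move=> t _ /=; rewrite lee_fin (ger0_norm (cmod_ge0 _)) Im_le_cmod.
Qed.

Lemma cintegrableD f g : cintegrable f -> cintegrable g -> cintegrable (f \+ g).
Proof.
move=> [mf fi] [mg gi].
apply: (cintegrable_le (cmeasurableD mf mg) (g := fun t => cmod (f t) + cmod (g t))).
  by apply: eq_integrable (integrableD _ fi gi).
by move=> t; exact: cmodD.
Qed.

Lemma cintegrableZ f (c : C) : cintegrable f -> cintegrable (fun t => c * f t).
Proof.
move=> [mf fi].
apply: (cintegrable_le (cmeasurableM (cmeasurable_cst c) mf)
  (g := fun t => cmod c * cmod (f t))).
  by apply: eq_integrable (integrableZl _ (cmod c) fi).
by move=> t; rewrite cmodM.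
Qed.

Lemma cintegralD f g : cintegrable f -> cintegrable g ->
  cintegral (f \+ g) = cintegral f + cintegral g.
Proof.
move=> fi gi; rewrite /cintegral /=.
under eq_Rintegral do rewrite ReD.
under [X in _ +i* X]eq_Rintegral do rewrite ImD.
rewrite (RintegralD _ (integrable_Re fi) (integrable_Re gi)) //.
by rewrite (RintegralD _ (integrable_Im fi) (integrable_Im gi)).
Qed.

Lemma cintegralZ f (c : C) : cintegrable f ->
  cintegral (fun t => c * f t) = c * cintegral f.
Proof.
move=> fi; have fr := integrable_Re fi; have fI := integrable_Im fi.
have iZ (a : R) (F : R -> R) : mu.-integrable setT (EFin \o F) ->
    mu.-integrable setT (EFin \o (fun t => a * F t)).
  by move=> Fi; apply: eq_integrable (integrableZl _ a Fi).
rewrite /cintegral.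
under eq_Rintegral do rewrite ReM.
under [X in _ +i* X]eq_Rintegral do rewrite ImM.
rewrite (RintegralB _ (iZ _ _ fr) (iZ _ _ fI)) // (RintegralD _ (iZ _ _ fI) (iZ _ _ fr)) //.
by rewrite !(RintegralZl _ _ fr) ?(RintegralZl _ _ fI) //; case: c.
Qed.

Lemma cintegralB f g : cintegrable f -> cintegrable g ->
  cintegral (f \- g) = cintegral f - cintegral g.
Proof.
move=> fi gi; rewrite (_ : f \- g = f \+ (fun t => -1 * g t)).
  by rewrite cintegralD // ?cintegralZ // ?mulN1r //; exact: cintegrableZ.
by apply/funext => t /=; rewrite mulN1r.
Qed.

Lemma cintegrable0 : cintegrable (fun=> 0).
Proof.
split; first exact: cmeasurable_cst.
by under eq_fun do rewrite cmod0; exact: integrable0.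
Qed.

Lemma cintegral0 : cintegral (fun=> 0) = 0 :> C.
Proof. by rewrite /cintegral /= /Rintegral integral0. Qed.

Lemma cintegral_sum (I : Type) (r : seq I) (F : I -> R -> C) :
  (forall i, cintegrable (F i)) ->
  cintegral (fun t => \sum_(i <- r) F i t) = \sum_(i <- r) cintegral (F i).
Proof.
(* Additivity needs the tail of the sum to be integrable, so integrability and value go through one
   induction. *)
move=> iF; suff : cintegrable (fun t => \sum_(i <- r) F i t) /\
    cintegral (fun t => \sum_(i <- r) F i t) = \sum_(i <- r) cintegral (F i) by case.
elim: r => [|i r [IHi IH]].
  under eq_fun do rewrite big_nil.
  by rewrite big_nil cintegral0; split => //; exact: cintegrable0.
under eq_fun do rewrite big_cons; rewrite big_cons -IH; split.
  exact: cintegrableD.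
exact: (cintegralD (iF i) IHi).
Qed.

Lemma cintegralJ f : cintegrable f ->
  cintegral (fun t => (f t)^*) = (cintegral f)^*.
Proof.
move=> fi; rewrite /cintegral /=; congr (_ +i* _).
  by apply: eq_Rintegral => t _; case: (f t).
rewrite -mulN1r -(RintegralZl _ _ (integrable_Im fi)) //.
by apply: eq_Rintegral => t _; rewrite mulN1r /=; case: (f t).
Qed.

Lemma cintegral_ae f g : cmeasurable f -> cmeasurable g -> aeq f g ->
  cintegral f = cintegral g.
Proof.
move=> [f1 f2] [g1 g2] fg; rewrite /cintegral /Rintegral; congr (fine _ +i* fine _).
  apply: ae_eq_integral => //; [exact/measurable_EFinP|exact/measurable_EFinP|].
  by apply: ae_circS fg => t + Dt => ->.
apply: ae_eq_integral => //; [exact/measurable_EFinP|exact/measurable_EFinP|].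
by apply: ae_circS fg => t + Dt => ->.
Qed.

(** The factor 2 comes from estimating real and imaginary parts separately; any constant serves for
    passing to limits. *)
Lemma cmod_cintegral f : cintegrable f ->
  cmod (cintegral f) <= 2 * fine (\int[mu]_t (cmod (f t))%:E).
Proof.
move=> [mf fi]; apply: le_trans (cmod_le_ReIm _) _; rewrite mulr_natl mulr2n.
have ir := integrable_Re (conj mf fi); have ii := integrable_Im (conj mf fi).
rewrite lerD //= (le_trans (le_normr_Rintegral _ _)) //.
  apply: le_Rintegral => //.
    by apply: eq_integrable (integrable_abse ir).
  by move=> t _; exact: Re_le_cmod.
apply: le_Rintegral => //.
  by apply: eq_integrable (integrable_abse ii).
by move=> t _; exact: Im_le_cmod.
Qed.

Lemma cintegral_cvg (F : nat -> R -> C) f :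
  (forall n, cintegrable (F n)) -> cintegrable f ->
  (forall e : R, 0 < e -> \forall n \near \oo,
     (\int[mu]_t (cmod (F n t - f t))%:E < e%:E)%E) ->
  cintegral (F n) @[n --> \oo] --> (cintegral f : C^o).
Proof.
move=> iF fi cF; apply/cvgC_cmod/cvgrPdist_lt => e e0.
have := cF (e / 2); rewrite divr_gt0 // => /(_ isT); apply: filterS => n.
have Nfi : cintegrable (fun t => -1 * f t) by exact: cintegrableZ.
have [mD iD] : cintegrable (F n \- f).
  rewrite (_ : F n \- f = F n \+ (fun t => -1 * f t)); first exact: cintegrableD.
  by apply/funext => t /=; rewrite mulN1r.
rewrite sub0r normrN (ger0_norm (cmod_ge0 _)) -cintegralB // => h.
rewrite (le_lt_trans (cmod_cintegral (conj mD iD))) // mulrC -ltr_pdivlMr //.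
by rewrite -lte_fin fineK // (integrable_fin_num _ iD).
Qed.

End CircleIntegral.

(** * Square-integrable and essentially bounded functions, and their pairing *)

Section SquareIntegrable.
Variable R : realType.
Local Notation C := R[i].
Local Notation mu := (circ R).
Implicit Types (f g h k : R -> C).

Definition sqintegrable f := cmeasurable f /\
  mu.-integrable setT (fun t => (cmod (f t) ^+ 2)%:E).

Lemma poweR2_Lnorm f :
  ('N[mu]_2%:E [(fun t => (cmod (f t))%:E)] `^ 2 =
   \int[mu]_t (cmod (f t) ^+ 2)%:E)%E.
Proof.
rewrite poweR_Lnorm //; apply: eq_integral => t _.
by rewrite gee0_abs ?lee_fin ?cmod_ge0 // poweR_EFin powR_mulrn // cmod_ge0.
Qed.

Lemma Lnorm2_le f (M : R) : 0 <= M ->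
  ('N[mu]_2%:E [(fun t => (cmod (f t))%:E)] <= M%:E)%E =
  (\int[mu]_t (cmod (f t) ^+ 2)%:E <= (M ^+ 2)%:E)%E.
Proof.
move=> M0; rewrite -poweR2_Lnorm.
have N0 := Lnorm_ge0 mu 2%:E (fun t => (cmod (f t))%:E).
case: (Lnorm mu _ _) N0 => [r r0|_|] //; last by rewrite poweRyr ?pnatr_eq0.
by rewrite poweR_EFin !lee_fin powR_mulrn // ler_sqr.
Qed.

Lemma measurable_cmod2 f : cmeasurable f ->
  @measurable_fun _ _ (measurableTypeR R) _ setT (fun t => (cmod (f t) ^+ 2)%:E).
Proof. by move=> mf; apply/measurable_EFinP; apply: measurable_funX; exact: measurable_cmod. Qed.

Lemma integral_cmod2_le f (B : R) : cmeasurable f -> (forall t, cmod (f t) <= B) ->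
  (\int[mu]_t (cmod (f t) ^+ 2)%:E <= (B ^+ 2)%:E)%E.
Proof.
move=> mf fB; apply: (@le_trans _ _ (\int[mu]_t (B ^+ 2)%:E)%E).
  apply: ge0_le_integral => //.
  - by move=> t _; rewrite lee_fin sqr_ge0.
  - exact: measurable_cmod2.
  - by move=> t _; rewrite lee_fin lerXn2r ?nnegrE ?cmod_ge0 ?(le_trans (cmod_ge0 (f t))).
rewrite integral_cst //.
by rewrite -[leRHS]mule1 lee_wpmul2l ?lee_fin ?sqr_ge0 // probability_le1.
Qed.

Lemma sqintegrableE f : cmeasurable f ->
  mu.-integrable setT (fun t => (cmod (f t) ^+ 2)%:E) <->
  (\int[mu]_t (cmod (f t) ^+ 2)%:E < +oo)%E.
Proof.
move=> mf; split => [/integrableP[_]|h].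
  by under eq_integral do rewrite gee0_abs ?lee_fin ?sqr_ge0 //.
apply/integrableP; split; first exact: measurable_cmod2.
by under eq_integral do rewrite gee0_abs ?lee_fin ?sqr_ge0 //.
Qed.

Lemma Lp2P f : Lp 2%:E f <-> sqintegrable f.
Proof.
split=> -[mf h]; split => //.
  apply/sqintegrableE => //; rewrite -poweR2_Lnorm.
  exact: poweR_lty.
have := (sqintegrableE mf).1 h; rewrite -poweR2_Lnorm.
have := Lnorm_ge0 mu 2%:E (fun t => (cmod (f t))%:E).
by case: (Lnorm mu _ _) => [r| |] // _; rewrite ?ltry // poweRyr ?pnatr_eq0.
Qed.

Lemma LpooP f : Lp +oo%E f <->
  cmeasurable f /\ exists M : R, {ae mu, forall t, cmod (f t) <= M}.
Proof.
(* The L^oo norm is defined as the essential supremum only when the total mass is positive. *)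
have mu1 : (0 < mu setT)%E by rewrite probability_setT.
have NE : ('N[mu]_+oo%E [(fun t => (cmod (f t))%:E)] =
    ess_sup mu (abse \o (fun t => (cmod (f t))%:E)))%E by rewrite unlock mu1.
split => -[mf].
  rewrite NE; set s := ess_sup _ _ => sy; split => //; exists (fine s).
  have := ess_sup_ge mu (abse \o (fun t : R => (cmod (f t))%:E)).
  rewrite -/s; apply: ae_circS => t /=.
  move: sy; case: s => [r| |] //= _.
  by rewrite lee_fin; apply: le_trans; exact: ler_norm.
move=> [M fM]; split => //; apply: (@le_lt_trans _ _ M%:E); last by rewrite ltry.
rewrite NE; apply/ess_supP.
have fME : {ae mu, forall t, (`|(cmod (f t))%:E| <= M%:E)%E}.
  by apply: ae_circS fM => t; rewrite lee_fin (ger0_norm (cmod_ge0 _)).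
exact: fME.
Qed.

Lemma sqintegrable_le f g (M : R) : cmeasurable f -> sqintegrable g -> 0 <= M ->
  {ae mu, forall t, cmod (f t) <= M * cmod (g t)} -> sqintegrable f.
Proof.
move=> mf [mg gi] M0 fg; split => //; apply/sqintegrableE => //.
have igi : mu.-integrable setT (fun t => ((M ^+ 2)%:E * (cmod (g t) ^+ 2)%:E)%E).
  exact: integrableZl.
apply: (@le_lt_trans _ _ (\int[mu]_t ((M ^+ 2)%:E * (cmod (g t) ^+ 2)%:E))%E).
  apply: ae_ge0_le_integral => //.
  - by move=> t _; rewrite lee_fin sqr_ge0.
  - exact: measurable_cmod2.
  - by move=> t _; rewrite lee_fin mulr_ge0 ?sqr_ge0.
  - by case/integrableP: igi.
  - apply: ae_circS fg => t h _.
    by rewrite lee_fin -exprMn ler_sqr ?nnegrE ?mulr_ge0 ?cmod_ge0.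
by rewrite ltey_eq (integrable_fin_num _ igi).
Qed.

Lemma sqintegrableM f g : cmeasurable g -> (exists M : R, {ae mu, forall t, cmod (g t) <= M}) ->
  sqintegrable f -> sqintegrable (g \* f).
Proof.
(* The bound [M] comes without a sign, hence the maximum with 0. *)
move=> mg [M gM] fi; apply: (@sqintegrable_le _ f (Num.max 0 M)) => //.
- by apply: cmeasurableM => //; case: fi.
- by rewrite le_max lexx.
- apply: ae_circS gM => t h /=; rewrite cmodM ler_wpM2r ?cmod_ge0 //.
  by rewrite le_max h orbT.
Qed.

Lemma sqintegrable_cst (c : C) : sqintegrable (fun=> c).
Proof.
by split; [exact: cmeasurable_cst | exact: finite_measure_integrable_cst].
Qed.

(** Dominated by [|f|^2 + |g|^2], in place of the Cauchy-Schwarz inequality. *)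
Lemma cintegrable_mulJ f g : sqintegrable f -> sqintegrable g ->
  cintegrable (fun t => f t * (g t)^*).
Proof.
move=> [mf fi] [mg gi].
apply: (@cintegrable_le _ _ (fun t => cmod (f t) ^+ 2 + cmod (g t) ^+ 2)).
- exact: (cmeasurableM mf (cmeasurableJ mg)).
- by apply: eq_integrable (integrableD _ fi gi).
- move=> t; rewrite cmodM cmodJ; have := sqr_ge0 (cmod (f t) - cmod (g t)).
  have := mulr_ge0 (cmod_ge0 (f t)) (cmod_ge0 (g t)); nra.
Qed.

Lemma innerC f g : sqintegrable f -> sqintegrable g -> inner f g = (inner g f)^*.
Proof.
move=> fi gi; rewrite /inner -cintegralJ; last exact: cintegrable_mulJ.
by congr cintegral; apply/funext => t; case: (f t) (g t) => [? ?] [? ?]; simpc; congr (_ +i* _); ring.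
Qed.

(** The integrands are compared rather than the arguments, because in the main computations a factor
    moves from one argument of the pairing to the other. *)
Lemma inner_ae f f' g g' : cmeasurable f -> cmeasurable f' ->
  cmeasurable g -> cmeasurable g' ->
  aeq (fun t => f t * (g t)^*) (fun t => f' t * (g' t)^*) -> inner f g = inner f' g'.
Proof.
move=> mf mf' mg mg' ?; apply: cintegral_ae => //.
- exact: (cmeasurableM mf (cmeasurableJ mg)).
- exact: (cmeasurableM mf' (cmeasurableJ mg')).
Qed.

(** The weak convergence behind every limit below: the error is at most a constant times the
    integral of [|k| |F n - f|], to which [integral_mul_near0] applies. *)
Lemma inner_cvg (F : nat -> R -> C) f k (M : R) :
  (forall n, cmeasurable (F n)) ->
  (forall n, (\int[mu]_t (cmod (F n t) ^+ 2)%:E <= M%:E)%E) ->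
  {ae mu, forall t, F n t @[n --> \oo] --> (f t : C^o)} ->
  sqintegrable f -> sqintegrable k ->
  inner (F n) k @[n --> \oo] --> (inner f k : C^o).
Proof.
move=> mF FM cF fi ki.
have iF n : sqintegrable (F n).
  by split => //; apply/sqintegrableE => //; apply: le_lt_trans (FM n) _; rewrite ltry.
have [mf f2] := fi; have [mk k2] := ki.
have ff := integrable_fin_num measurableT f2.
apply: cintegral_cvg => [n||e e0]; [exact: cintegrable_mulJ|exact: cintegrable_mulJ|].
have mD n : cmeasurable (F n \- f) by exact: cmeasurableB.
have int2 g : cmeasurable g -> (\int[mu]_t (2%:E * (cmod (g t) ^+ 2)%:E) =
    2%:E * \int[mu]_t (cmod (g t) ^+ 2)%:E)%E.
  move=> mg; apply: ge0_integralZl => //; first exact: measurable_cmod2.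
  by move=> t _; rewrite lee_fin sqr_ge0.
(* From [|x - y|^2 <= 2 |x|^2 + 2 |y|^2]. *)
have DM n : (\int[mu]_t (cmod (F n t - f t) ^+ 2)%:E <=
    (2 * M + 2 * fine (\int[mu]_t (cmod (f t) ^+ 2)%:E))%:E)%E.
  apply: (@le_trans _ _ (\int[mu]_t
    (2%:E * (cmod (F n t) ^+ 2)%:E + 2%:E * (cmod (f t) ^+ 2)%:E))%E).
    apply: ge0_le_integral => //.
    + by move=> t _; rewrite lee_fin sqr_ge0.
    + exact: (measurable_cmod2 (mD n)).
    + by apply: emeasurable_funD; apply: measurable_funeM; exact: measurable_cmod2.
    + move=> t _; rewrite lee_fin; have := cmodD (F n t) (- f t); rewrite cmodN.
      have := cmod_ge0 (F n t - f t); have := cmod_ge0 (F n t); have := cmod_ge0 (f t).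
      have := sqr_ge0 (cmod (F n t) - cmod (f t)); nra.
  rewrite ge0_integralD //.
  + rewrite (int2 _ (mF n)) (int2 _ mf) (EFinD (2 * M)).
    apply: leeD; first exact: (@lee_wpmul2l _ 2%:E _ _ M%:E).
    by rewrite -{1}(fineK ff).
  + by move=> t _; rewrite lee_fin mulr_ge0 ?sqr_ge0.
  + by apply: measurable_funeM; exact: measurable_cmod2.
  + by move=> t _; rewrite lee_fin mulr_ge0 ?sqr_ge0.
  + by apply: measurable_funeM; exact: measurable_cmod2.
have D0 : {ae mu, forall t, cmod (F n t - f t) @[n --> \oo] --> 0}.
  by apply: ae_circS cF => t /cvgC_cmod.
have [N _ hN] := @integral_mul_near0 _ _ _ mu (fun t => cmod (k t))
  (fun n t => cmod (F n t - f t)) _ (measurable_cmod mk)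
  (fun n => measurable_cmod (mD n)) (fun _ => cmod_ge0 _)
  (fun _ _ => cmod_ge0 _) k2 DM D0 e e0.
exists N => // n Nn; apply: le_lt_trans (hN n Nn).
rewrite le_eqVlt; apply/orP; left; apply/eqP; apply: eq_integral => t _.
by rewrite -mulrBl cmodM cmodJ mulrC.
Qed.

End SquareIntegrable.

(** * Orthonormality of the monomials on the circle *)

Section Fourier.
Variable R : realType.
Local Notation C := R[i].
Local Notation mu := (circ R).
Implicit Types (f g h k : R -> C).

Lemma expiX (t : R) n : expi t ^+ n = expi (n%:R * t).
Proof.
elim: n => [|n IH]; first by rewrite expr0 mul0r /expi cos0 sin0.
rewrite exprS IH /expi -natr1 mulrDl mul1r addrC cosD sinD.
by apply/eqP; rewrite eq_complex /=; apply/andP; split; apply/eqP; ring.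
Qed.

Lemma cmod_expi (t : R) : cmod (expi t) = 1.
Proof. by rewrite /cmod normc_def /= cos2Dsin2 sqrtr1. Qed.

Lemma cmod_radial (r t : R) : cmod (r%:C * expi t) = `|r|.
Proof. by rewrite cmodM cmod_real cmod_expi mulr1. Qed.

Lemma measurable_circle_fun (f : R -> R) : continuous f ->
  @measurable_fun _ _ (measurableTypeR R) R setT f.
Proof. exact: continuous_measurable_fun. Qed.

Lemma continuous_cosM (a : R) : continuous (fun t : R => cos (a * t)).
Proof.
by move=> t; apply: continuous_comp; [exact: mulrl_continuous|exact: continuous_cos].
Qed.

Lemma continuous_sinM (a : R) : continuous (fun t : R => sin (a * t)).
Proof.
by move=> t; apply: continuous_comp; [exact: mulrl_continuous|exact: continuous_sin].
Qed.

Lemma cmeasurable_expiX n : cmeasurable (fun t : R => expi t ^+ n).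
Proof.
under eq_fun do rewrite expiX.
split => /=; apply: measurable_circle_fun; [exact: continuous_cosM|exact: continuous_sinM].
Qed.

Lemma sqintegrable_expiX n : sqintegrable (fun t : R => expi t ^+ n).
Proof.
apply: (sqintegrable_le (cmeasurable_expiX n) (sqintegrable_cst (1 : C)) ler01).
by apply: aeW => t; rewrite cmodX cmod_expi expr1n cmod1 mulr1.
Qed.

Lemma circ_integral_FTC (f F : R -> R) : continuous f ->
  (forall x : R, is_derive x 1 F (f x)) -> (forall x, 0 <= f x) ->
  (\int[mu]_t (f t)%:E)%E = ((2 * pi)^-1 * (F (2 * pi) - F 0))%:E.
Proof.
move=> cf dF f0.
rewrite /circ integral_uniform; last 2 first.
- by apply/measurable_EFinP; exact: measurable_circle_fun.
- by move=> x; rewrite lee_fin.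
rewrite subr0 EFinM; congr (_ * _)%E.
have cF : continuous F.
  by move=> x; apply: differentiable_continuous; apply/derivable1_diffP; case: (dF x).
rewrite (@continuous_FTC2 _ f F) ?EFinB //.
- exact: two_pi_gt0.
- exact: continuous_subspaceT.
- split; first by move=> x _; case: (dF x).
  + by apply: cvg_at_right_filter; exact: cF.
  + by apply: cvg_at_left_filter; exact: cF.
- by move=> x _; rewrite derive1E; case: (dF x).
Qed.

Lemma circ_Rintegral_mean0 (f F : R -> R) : continuous f ->
  (forall x : R, is_derive x 1 F (f x)) -> (forall x, `|f x| <= 1) ->
  F (2 * pi) = F 0 -> \int[mu]_t f t = 0.
Proof.
move=> cf dF f1 FE.
have mf := measurable_circle_fun cf.
have i1 : mu.-integrable setT (EFin \o (fun=> 1 : R)).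
  exact: finite_measure_integrable_cst.
have fi : mu.-integrable setT (EFin \o f).
  apply: le_integrable i1 => //; first exact/measurable_EFinP.
  by move=> t _ /=; rewrite lee_fin normr1 f1.
(* The formula for integrals against [uniform_prob] requires a nonnegative
   function, hence the shift by 1. *)
have : \int[mu]_t (1 + f t) = 1.
  rewrite /Rintegral (@circ_integral_FTC _ (fun x => x + F x)) /=.
  - by rewrite FE add0r addrK mulVf // gt_eqF // two_pi_gt0.
  - by move=> x; apply: continuousD; [exact: cst_continuous|exact: cf].
  - by move=> x; have := f1 x; rewrite ler_norml; lra.
have -> : \int[mu]_t (1 + f t) = 1 + \int[mu]_t f t.
  rewrite (RintegralD _ i1 fi) // Rintegral_cst // mul1r.
  by have -> : fine (mu setT) = 1 by rewrite probability_setT.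
lra.
Qed.

Lemma is_derive_mulr (a x : R) : is_derive x 1 (fun t : R => a * t) a.
Proof.
by apply: (is_derive_eq (is_deriveZ a (is_derive_id x (1 : R)))); rewrite /GRing.scale /= mulr1.
Qed.

Lemma is_derive_rescaled (F : R -> R) (a x dF : R) : a != 0 ->
  is_derive (a * x) 1 F dF -> is_derive x 1 (fun t : R => F (a * t) / a) dF.
Proof.
move=> a0 HF.
have H := is_deriveZ a^-1 (@is_derive1_comp R F (fun t => a * t) x _ _ HF (is_derive_mulr a x)).
rewrite (_ : (fun t : R => F (a * t) / a) = a^-1 *: (F \o (fun t => a * t))).
  by apply: (is_derive_eq H); rewrite /GRing.scale /=; field.
by apply/funext => t /=; rewrite mulrC.
Qed.

Lemma cintegral_expiX n : cintegral (fun t : R => expi t ^+ n) = (n == 0%N)%:R :> C.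
Proof.
case: n => [|n].
  rewrite /cintegral /= Rintegral_cst // Rintegral_cst // mul0r mul1r.
  by have -> : fine (mu setT) = 1 by rewrite probability_setT.
have n0 : n.+1%:R != 0 :> R by rewrite pnatr_eq0.
under eq_fun do rewrite expiX.
have per : n.+1%:R * (2 * pi) = (pi *+ 2) *+ n.+1 :> R by rewrite !mulr_natl.
have dsin (x : R) : is_derive x 1 (fun t => sin (n.+1%:R * t) / n.+1%:R) (cos (n.+1%:R * x)).
  exact: is_derive_rescaled.
have dcos (x : R) : is_derive x 1 (fun t => - cos (n.+1%:R * t) / n.+1%:R) (sin (n.+1%:R * x)).
  apply: (@is_derive_rescaled (- cos)) => //.
  by apply: (is_derive_eq (is_deriveN (is_derive_cos _))); rewrite opprK.
rewrite /cintegral /= (circ_Rintegral_mean0 _ dsin).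
- rewrite (circ_Rintegral_mean0 _ dcos) //.
  + exact: continuous_sinM.
  + by move=> x; rewrite ler_norml sin_geN1 sin_le1.
  + by rewrite per -(add0r (_ *+ n.+1)) (periodicn (@cosD2pi R)) mulr0.
- exact: continuous_cosM.
- by move=> x; rewrite ler_norml cos_geN1 cos_le1.
- by rewrite per -(add0r (_ *+ n.+1)) (periodicn (@sinD2pi R)) mulr0.
Qed.

Lemma expiXJ n (t : R) : expi t ^+ n * (expi t ^+ n)^* = 1.
Proof. by rewrite -sqr_normc normC_cmod cmodX cmod_expi expr1n expr1n. Qed.

(** Only natural exponents have been integrated: for [m <= j] the integrand is [expi t ^+ (j - m)],
    and the other case follows by conjugation. *)
Lemma inner_expiX j m : inner (fun t : R => expi t ^+ j) (fun t => expi t ^+ m) =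
  (j == m)%:R :> C.
Proof.
have le n p : (p <= n)%N ->
    inner (fun t : R => expi t ^+ n) (fun t => expi t ^+ p) = (n == p)%:R :> C.
  move=> pn; have -> : (n == p) = (n - p == 0)%N by rewrite subn_eq0 eqn_leq pn andbT.
  rewrite -cintegral_expiX.
  congr cintegral; apply/funext => t.
  by rewrite -{1}(subnK pn) exprD -mulrA expiXJ mulr1.
have [/le//|/ltnW/le h] := leqP m j.
rewrite (innerC (sqintegrable_expiX j) (sqintegrable_expiX m)) h eq_sym.
exact: conjc_nat.
Qed.

End Fourier.

(** * Power series on the disc and their boundary values *)

Section PowerSeries.
Variable R : realType.
Local Notation C := R[i].
Local Notation mu := (circ R).
Implicit Types (a b : nat -> C) (U V : C -> C) (f g h : R -> C).

Definition has_series a U : Prop := forall z : C, `|z| < 1 ->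
  (series (fun k => a k * z ^+ k) : nat -> C^o) @ \oo --> (U z : C^o).

Lemma cvgC_unique (u : nat -> C) (l m : C) :
  u @ \oo --> (l : C^o) -> u @ \oo --> (m : C^o) -> l = m.
Proof.
move=> /cvgC_ReIm[l1 l2] /cvgC_ReIm[m1 m2]; apply/eqP; rewrite eq_complex.
rewrite -(cvg_lim (@Rhausdorff R) l1) -(cvg_lim (@Rhausdorff R) l2).
by rewrite -(cvg_lim (@Rhausdorff R) m1) -(cvg_lim (@Rhausdorff R) m2) !eqxx.
Qed.

Lemma cvg_has_upper_bound (u : nat -> R) (l : R) : u @ \oo --> l ->
  exists B, forall n, u n <= B.
Proof.
move=> ul; have /cvg_seq_bounded/pinfty_ex_gt0[B _ hB] : cvgn u by apply/cvg_ex; exists l.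
by exists B => n; apply: le_trans (ler_norm _) (hB n I).
Qed.

(** Convergence at the midpoint [s] between [r] and 1 bounds the terms [a n * s ^+ n], which are
    differences of partial sums; the ratio is then [r / s]. *)
Lemma has_series_geometric a U (r : R) : has_series a U -> 0 <= r < 1 ->
  exists A q, [/\ 0 <= A, 0 <= q < 1 & forall n, cmod (a n) * r ^+ n <= A * q ^+ n].
Proof.
move=> aU /andP[r0 r1]; pose s : R := (1 + r) / 2.
have s0 : 0 < s by rewrite /s; lra.
have s1 : s < 1 by rewrite /s; lra.
have rs : r < s by rewrite /s; lra.
have sC : `|s%:C| < (1 : C) by rewrite cmod_lt cmod_real gtr0_norm.
have /cvgC_cmod := aU _ sC.
set S := series _; set l := U _ => /cvg_has_upper_bound[B hB].
have B0 : 0 <= B by rewrite (le_trans (cmod_ge0 _) (hB 0%N)).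
have q0 : 0 <= r / s by rewrite divr_ge0 // ltW.
exists (B + B), (r / s); split; [exact: addr_ge0| |move=> n].
  by rewrite q0 /= ltr_pdivrMr // mul1r.
have -> : r ^+ n = s ^+ n * (r / s) ^+ n by rewrite -exprMn mulrC divfK // gt_eqF.
rewrite mulrA ler_wpM2r ?exprn_ge0 //.
have -> : cmod (a n) * s ^+ n = cmod (S n.+1 - S n).
  by rewrite /S /series /= big_nat_recr //= addrAC subrr add0r cmodM cmodX cmod_real gtr0_norm.
rewrite (_ : S n.+1 - S n = (S n.+1 - l) - (S n - l)); last by ring.
by rewrite (le_trans (cmodD _ _)) // cmodN lerD.
Qed.

Lemma geometric_sum_le (q : R) N : 0 <= q < 1 -> \sum_(0 <= n < N) q ^+ n <= (1 - q)^-1.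
Proof.
move=> /andP[q0 q1]; have q1' : 0 < 1 - q by rewrite subr_gt0.
rewrite -(ler_pM2l q1') divff ?gt_eqF // big_mkord.
by rewrite -opprB mulNr -subrX1 opprB lerBlDr lerDl exprn_ge0.
Qed.

(** The bound is uniform in [N] and on the whole circle of radius [r], as needed for termwise
    integration there. *)
Lemma has_series_bounded a U (r : R) : has_series a U -> 0 <= r < 1 ->
  exists B, 0 <= B /\ forall N z, cmod z = r ->
    cmod (series (fun n => a n * z ^+ n) N) <= B.
Proof.
move=> aU r01; have [A [q [A0 q01 h]]] := has_series_geometric aU r01.
have q1 : 0 < 1 - q by rewrite subr_gt0; case/andP: q01.
exists (A * (1 - q)^-1); split; first by rewrite mulr_ge0 // invr_ge0 ltW.
move=> N z zr; apply: le_trans (ler_wpM2l A0 (geometric_sum_le N q01)).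
rewrite mulr_sumr /series /= (le_trans (cmod_sum _ _ _)) // ler_sum // => n _.
by rewrite cmodM cmodX zr.
Qed.

Lemma cmeasurable_partial_sum a (r : R) N :
  cmeasurable (fun t => series (fun n => a n * (r%:C * expi t) ^+ n) N).
Proof.
apply: cmeasurable_sum => n; under eq_fun do rewrite exprMn mulrA.
apply: (cmeasurableM (cmeasurable_cst (a n * r%:C ^+ n))).
exact: cmeasurable_expiX.
Qed.

Lemma cmeasurable_radial a U (r : R) : has_series a U -> 0 <= r < 1 ->
  cmeasurable (fun t => U (r%:C * expi t)).
Proof.
move=> aU /andP[r0 r1]; apply: (cmeasurable_cvg (cmeasurable_partial_sum a r)) => t.
by apply: aU; rewrite cmod_lt cmod_radial ger0_norm.
Qed.

(** Inside the disc the partial sums are uniformly bounded on the circle and converge pointwise, so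
    [inner_cvg] allows termwise integration. *)
Lemma inner_radial a U (r : R) h : has_series a U -> 0 <= r < 1 -> sqintegrable h ->
  series (fun n => a n * r%:C ^+ n * inner (fun t => expi t ^+ n) h) @ \oo -->
  (inner (fun t => U (r%:C * expi t)) h : C^o).
Proof.
move=> aU r01 hi; have [r0 r1] := andP r01.
have [B [B0 hB]] := has_series_bounded aU r01.
have mU := cmeasurable_radial aU r01.
have cU t : series (fun n => a n * (r%:C * expi t) ^+ n) @ \oo --> (U (r%:C * expi t) : C^o).
  by apply: aU; rewrite cmod_lt cmod_radial ger0_norm.
(* The limit inherits the bound of the partial sums. *)
have UB t : cmod (U (r%:C * expi t)) <= B.
  apply/ler_addgt0Pr => e e0; have /cvgC_cmod/cvgrPdist_lt/(_ e e0)[N _ /(_ N (leqnn N))] := cU t.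
  rewrite /= sub0r normrN ger0_norm ?cmod_ge0 // => hN.
  set S := series _ N in hN; rewrite (_ : U _ = S + - (S - U (r%:C * expi t))); last by ring.
  rewrite (le_trans (cmodD _ _)) // cmodN lerD // ?(ltW hN) //.
  by apply: hB; rewrite cmod_radial ger0_norm.
have -> : series (fun n => a n * r%:C ^+ n * inner (fun t => expi t ^+ n) h) =
    (fun N => inner (fun t => series (fun n => a n * (r%:C * expi t) ^+ n) N) h).
  apply/funext => N; rewrite /series /= /inner.
  under [X in _ = cintegral X]eq_fun do rewrite mulr_suml.
  rewrite cintegral_sum; last first.
    move=> n; under eq_fun do rewrite exprMn mulrA -[_ * _ * (h _)^*]mulrA.
    by apply: cintegrableZ; apply: cintegrable_mulJ => //; exact: sqintegrable_expiX.
  apply: eq_bigr => n _; rewrite -cintegralZ; last first.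
    by apply: cintegrable_mulJ => //; exact: sqintegrable_expiX.
  by congr cintegral; apply/funext => t; rewrite exprMn !mulrA.
apply: (@inner_cvg _ _ _ _ (B ^+ 2)) => //.
- by move=> n; exact: cmeasurable_partial_sum.
- move=> N; apply: integral_cmod2_le; first exact: cmeasurable_partial_sum.
  by move=> t; apply: hB; rewrite cmod_radial ger0_norm.
- exact: aeW.
- apply: (sqintegrable_le mU (sqintegrable_cst (1 : C)) B0).
  by apply: aeW => t; rewrite cmod1 mulr1.
Qed.

(** Turns the radial limit at [1^'-] into the limit of a sequence, the form required by
    [inner_cvg]. *)
Definition radius (n : nat) : R := 1 - n.+1%:R^-1.

Lemma radius01 n : 0 <= radius n < 1.
Proof.
have n0 : 0 < n.+1%:R^-1 :> R by rewrite invr_gt0.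
by rewrite /radius subr_ge0 ltrBlDr ltrDl n0 andbT invf_le1 // ler1n.
Qed.

Lemma cvg_radius : radius @ \oo --> (1 : R).
Proof.
rewrite -[X in _ --> X]subr0; apply: cvgB; first exact: cvg_cst.
exact: cvg_harmonic.
Qed.

Lemma cvg_radius_left : radius @ \oo --> (1 : R)^'-.
Proof.
move=> P P1; have [N _ hN] := cvg_radius (P1 : nbhs (1 : R) (fun x => x < 1 -> P x)).
exists N => // n Nn; apply: (hN n Nn).
by case/andP: (radius01 n).
Qed.

Lemma hardy2_discP U : hardy2_disc U <-> analytic_disc U /\
  exists M : R, 0 <= M /\ forall r, 0 <= r < 1 ->
    (\int[mu]_t (cmod (U (r%:C * expi t)) ^+ 2)%:E <= (M ^+ 2)%:E)%E.
Proof.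
split=> -[aU [M hM]]; split => //.
  have M0 : 0 <= M.
    rewrite -lee_fin; apply: le_trans (hM 0 _); last by rewrite lexx ltr01.
    exact: Lnorm_ge0.
  by exists M; split => // r r01; rewrite -Lnorm2_le // hM.
by case: hM => M0 hM; exists M => r r01; rewrite Lnorm2_le // hM.
Qed.

Lemma inner_boundary a U f h : has_series a U -> hardy2_disc U -> boundary_values U f ->
  sqintegrable f -> sqintegrable h ->
  inner (fun t => U ((radius n)%:C * expi t)) h @[n --> \oo] --> (inner f h : C^o).
Proof.
move=> aU /hardy2_discP[_ [M [_ hM]]] bU fi hi.
apply: (@inner_cvg _ _ _ _ (M ^+ 2)) => //.
- by move=> n; apply: cmeasurable_radial aU (radius01 n).
- by move=> n; apply: hM (radius01 n).
- by apply: ae_circS bU => t Ut; exact: (cvg_comp _ _ cvg_radius_left Ut).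
Qed.

(** Here [h] is any square-integrable function: it will be the product of a symbol and a kernel
    element, which is not expected to lie in H^2. *)
Lemma hardy2_orthogonal U f h : hardy2_disc U -> boundary_values U f ->
  sqintegrable f -> sqintegrable h ->
  (forall n, inner (fun t => expi t ^+ n) h = 0) -> inner f h = 0.
Proof.
move=> hU bU fi hi h0; have [a aU] := hU.1.
apply: (cvgC_unique (inner_boundary aU hU bU fi hi)).
rewrite (_ : (fun n => _) = fun=> 0); first exact: (@cvg_cst C^o).
apply/funext => n; apply: (cvgC_unique (inner_radial aU (radius01 n) hi)).
rewrite (_ : series _ = fun=> 0); first exact: (@cvg_cst C^o).
by apply/funext => N; rewrite /series /= big1 // => i _; rewrite h0 mulr0.
Qed.

(** By orthonormality the radial restriction to radius [r] pairs with the monomial to exactly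
    [a m * r ^+ m], and [r] tends to 1. *)
Lemma hardy2_coefficient a U f m : has_series a U -> hardy2_disc U -> boundary_values U f ->
  sqintegrable f -> inner f (fun t => expi t ^+ m) = a m.
Proof.
move=> aU hU bU fi; have ei := sqintegrable_expiX R m.
apply: (cvgC_unique (inner_boundary aU hU bU fi ei)).
have UE n : inner (fun t => U ((radius n)%:C * expi t)) (fun t => expi t ^+ m) =
    a m * (radius n)%:C ^+ m.
  apply: (cvgC_unique (inner_radial aU (radius01 n) ei)).
  (* From index [m + 1] on, the partial sums contain the single nonzero term and are constant. *)
  apply/cvgC_cmod/cvgrPdist_lt => e e0; exists m.+1 => // N /= mN.
  rewrite /series /= big_mkord (bigD1 (Ordinal mN)) //= inner_expiX eqxx mulr1.
  rewrite big1 ?addr0 ?subrr ?cmod0 ?subr0 ?normr0 // => i im.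
  by rewrite inner_expiX (_ : (i : nat) == m = false) ?mulr0 //; exact: negbTE.
under eq_fun do rewrite UE.
apply/cvgC_cmod; have : (1 - radius n ^+ m) * cmod (a m) @[n --> \oo] --> 0.
  rewrite -[0 in X in _ --> X](mul0r (cmod (a m))); apply: cvgMl.
  rewrite -[0 in X in _ --> X](subrr 1); apply: cvgB; first exact: cvg_cst.
  have := @cvg_comp _ _ _ radius (fun x => x ^+ m) _ _ _ cvg_radius (@exprn_continuous R m 1).
  by rewrite expr1n.
apply: cvg_trans; apply: near_eq_cvg; apply: nearW => n.
have /andP[r0 r1] := radius01 n.
have -> : a m * (radius n)%:C ^+ m - a m = - ((1 - (radius n)%:C ^+ m) * a m) by ring.
rewrite cmodN cmodM.
rewrite -rmorphXn -(rmorph1 (real_complex R)) -rmorphB cmod_real ger0_norm //.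
by rewrite subr_ge0 exprn_ile1 // ltW.
Qed.

End PowerSeries.

(** * Products of power series *)

Section CauchyProduct.
Variable R : realType.
Local Notation C := R[i].
Implicit Types (a b : nat -> C) (U V : C -> C).

Definition cauchy_prod a b (n : nat) : C := \sum_(i < n.+1) a i * b (n - i)%N.

(** Each of the [n] powers [w ^+ i] with [i < n] is at least [w ^+ n]. *)
Lemma natmul_geometric_le (w : R) n : 0 <= w < 1 -> n%:R * w ^+ n <= (1 - w)^-1.
Proof.
move=> w01; have /andP[w0 w1] := w01; apply: le_trans (geometric_sum_le n w01).
rewrite big_mkord mulr_natl -[n in leLHS]card_ord -sumr_const card_ord.
by apply: ler_sum => i _; rewrite ler_wiXn2l ?(ltW w1) // ltnW.
Qed.

(** With [t = w^2], one factor [w ^+ n] absorbs [n] and the other tends to 0. *)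
Lemma natmul_geometric_cvg0 (t : R) : 0 <= t < 1 -> n%:R * t ^+ n @[n --> \oo] --> 0.
Proof.
move=> /andP[t0 t1]; pose w := Num.sqrt t.
have w0 : 0 <= w := sqrtr_ge0 t.
have tw : t = w ^+ 2 by rewrite sqr_sqrtr.
have w1 : w < 1 by rewrite -(@ltr_sqr R) ?nnegrE // -tw expr1n.
have g0 : (1 - w)^-1 * w ^+ n @[n --> \oo] --> 0.
  by apply: cvg_geometric; rewrite ger0_norm.
apply: (squeeze_cvgr _ (cvg_cst 0) g0); apply: nearW => n.
rewrite mulr_ge0 ?exprn_ge0 //= tw -exprM mulnC exprM expr2 mulrA.
by rewrite ler_wpM2r ?exprn_ge0 // natmul_geometric_le // w0.
Qed.

Lemma sqr_natmul_geometric_cvg0 (s : R) : 0 <= s < 1 ->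
  n%:R ^+ 2 * s ^+ n @[n --> \oo] --> 0.
Proof.
move=> /andP[s0 s1]; pose t := Num.sqrt s.
have t0 : 0 <= t := sqrtr_ge0 s.
have st : s = t ^+ 2 by rewrite sqr_sqrtr.
have t1 : t < 1 by rewrite -(@ltr_sqr R) ?nnegrE // -st expr1n.
have g0 : n%:R * t ^+ n @[n --> \oo] --> 0.
  by apply: natmul_geometric_cvg0; rewrite t0.
rewrite (_ : (fun n => _) = (fun n => (n%:R * t ^+ n) * (n%:R * t ^+ n))).
  by rewrite -[0 in X in _ --> X](mulr0 0); apply: cvgM.
by apply/funext => n; rewrite st -exprM mulnC exprM -expr2 exprMn.
Qed.

(* The difference is the part of degree at least [N] of the product of the two
   truncated series. *)
Lemma cauchy_prod_partial a b z (A s : R) N : 0 <= A -> 0 <= s < 1 ->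
  (forall n, cmod (a n) * cmod z ^+ n <= A * s ^+ n) ->
  (forall n, cmod (b n) * cmod z ^+ n <= A * s ^+ n) ->
  cmod (series (fun n => a n * z ^+ n) N * series (fun n => b n * z ^+ n) N -
        series (fun n => cauchy_prod a b n * z ^+ n) N) <=
  2 * A ^+ 2 * (N%:R ^+ 2 * s ^+ N).
Proof.
move=> A0 /andP[s0 s1] ha hb.
pose p := \poly_(i < N) a i; pose q := \poly_(i < N) b i.
have pE : series (fun n => a n * z ^+ n) N = p.[z] by rewrite horner_poly /series /= big_mkord.
have qE : series (fun n => b n * z ^+ n) N = q.[z] by rewrite horner_poly /series /= big_mkord.
have coef_le (c : nat -> C) : (forall n, cmod (c n) * cmod z ^+ n <= A * s ^+ n) ->
    forall n, cmod (\poly_(i < N) c i)`_n * cmod z ^+ n <= A * s ^+ n.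
  move=> hc n; rewrite coef_poly; case: ifP => _; first exact: hc.
  by rewrite cmod0 mul0r mulr_ge0 // exprn_ge0.
have szpq : (size (p * q)%R <= N + N)%N.
  apply: leq_trans (size_polyMleq _ _) _; apply: leq_trans (leq_pred _) _.
  by apply: leq_add; exact: size_poly.
have -> : series (fun n => cauchy_prod a b n * z ^+ n) N =
    (* Truncation at degree [N] does not alter the product coefficients below [N]. *)
    \sum_(0 <= n < N) (p * q)`_n * z ^+ n.
  rewrite /series /=; apply: eq_big_nat => n /andP[_ nN]; congr (_ * _).
  rewrite coefM; apply: eq_bigr => j _.
  have jn : (j <= n)%N by rewrite -ltnS.
  by rewrite !coef_poly (leq_ltn_trans jn nN) (leq_ltn_trans (leq_subr j n) nN).
rewrite pE qE -hornerM (horner_coef_wide _ szpq) -(big_mkord xpredT (fun i => (p * q)`_i * z ^+ i)).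
rewrite (big_cat_nat (n := N)) ?leq_addr //= addrAC subrr add0r.
apply: le_trans (cmod_sum _ _ _) _.
(* There are [N] degrees [N <= n < 2N], each with [n + 1 <= 2N] products of size at most
   [A^2 s^n <= A^2 s^N]. *)
apply: (@le_trans _ _ (\sum_(N <= n < N + N) (2 * A ^+ 2 * (N%:R * s ^+ N)))); last first.
  rewrite sumr_const_nat addnK -mulr_natr le_eqVlt; apply/orP; left; apply/eqP; ring.
apply: ler_sum_nat => n /andP[Nn n2N].
have : cmod ((p * q)`_n * z ^+ n) <= n.+1%:R * (A ^+ 2 * s ^+ n).
  rewrite coefM mulr_suml (le_trans (cmod_sum _ _ _)) //.
  rewrite mulr_natl -[n.+1 in leRHS]card_ord -sumr_const.
  apply: ler_sum => j _; have jn : (j <= n)%N by rewrite -ltnS.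
  rewrite -[in z ^+ n](subnKC jn) -[in s ^+ n](subnKC jn) !exprD.
  rewrite (_ : _ * _ * _ = (p`_j * z ^+ j) * (q`_(n - j) * z ^+ (n - j))); last by ring.
  rewrite (_ : A ^+ 2 * _ = (A * s ^+ j) * (A * s ^+ (n - j))); last by ring.
  rewrite cmodM; apply: ler_pM; rewrite ?cmod_ge0 // cmodM cmodX.
    exact: coef_le.
  exact: coef_le.
move=> /le_trans; apply.
rewrite [leRHS](_ : _ = (N + N)%:R * (A ^+ 2 * s ^+ N)); last by rewrite natrD; ring.
apply: ler_pM; rewrite ?mulr_ge0 ?sqr_ge0 ?exprn_ge0 ?ler_nat //.
by rewrite ler_wpM2l ?sqr_ge0 // ler_wiXn2l // ltW.
Qed.

(** The product of the partial sums tends to [U z * V z], and it differs from the partial sum of the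
    product series by a constant times [N^2 s^N] with [s < 1]. *)
Lemma has_series_mul a b U V : has_series a U -> has_series b V ->
  has_series (cauchy_prod a b) (fun z => U z * V z).
Proof.
move=> aU bV z z1; apply/cvgC_cmod.
have r01 : 0 <= cmod z < 1 by rewrite cmod_ge0 -cmod_lt.
have [A [p [A0 /andP[p0 p1] hA]]] := has_series_geometric aU r01.
have [B [q [B0 /andP[q0 q1] hB]]] := has_series_geometric bV r01.
have [D [D0 hD]] := has_series_bounded bV r01.
(* [cauchy_prod_partial] wants one constant and one ratio for both series. *)
have M0 : 0 <= Num.max A B by rewrite le_max A0.
have s01 : 0 <= Num.max p q < 1 by rewrite le_max p0 /= gt_max p1.
have hA' n : cmod (a n) * cmod z ^+ n <= Num.max A B * Num.max p q ^+ n.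
  apply: le_trans (hA n) _; apply: ler_pM; rewrite ?exprn_ge0 // ?le_max ?lexx //.
  by rewrite lerXn2r ?nnegrE // le_max ?p0 ?lexx.
have hB' n : cmod (b n) * cmod z ^+ n <= Num.max A B * Num.max p q ^+ n.
  apply: le_trans (hB n) _; apply: ler_pM; rewrite ?exprn_ge0 // ?le_max ?lexx ?orbT //.
  by rewrite lerXn2r ?nnegrE // le_max ?q0 ?lexx ?orbT.
have cU := (cvgC_cmod _ _).1 (aU z z1); have cV := (cvgC_cmod _ _).1 (bV z z1).
set S := series _ in cU; set T := series _ in cV.
have bound : cmod (S n - U z) * D + cmod (U z) * cmod (T n - V z) +
    2 * Num.max A B ^+ 2 * (n%:R ^+ 2 * Num.max p q ^+ n) @[n --> \oo] --> 0.
  rewrite -[0 in X in _ --> X](addr0 0); apply: cvgD.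
    rewrite -[0 in X in _ --> X](addr0 0); apply: cvgD.
      by rewrite -[0 in X in _ --> X](mul0r D); apply: cvgMl; exact: cU.
    by rewrite -[0 in X in _ --> X](mulr0 (cmod (U z))); apply: cvgMr; exact: cV.
  rewrite -[0 in X in _ --> X](mulr0 (2 * Num.max A B ^+ 2)); apply: cvgMr.
  exact: sqr_natmul_geometric_cvg0.
apply: (squeeze_cvgr _ (cvg_cst 0) bound); apply: nearW => n; rewrite cmod_ge0 /=.
rewrite [X in cmod X](_ : _ = (S n - U z) * T n + U z * (T n - V z) +
    - (S n * T n - series (fun n => cauchy_prod a b n * z ^+ n) n)); last by ring.
apply: le_trans (cmodD _ _) _; apply: lerD.
  apply: le_trans (cmodD _ _) _; rewrite !cmodM lerD2r ler_wpM2l ?cmod_ge0 //.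
  exact: hD.
by rewrite cmodN; exact: cauchy_prod_partial.
Qed.

(** Formal power series have no zero divisors: [m] is the order of [b], and the product coefficient
    of index [n + m] reduces to [a n * b m], the terms before it vanishing by induction and those
    after it because their index in [b] is below [m]. *)
Lemma cauchy_prod_eq0 a b m : (forall n, cauchy_prod a b n = 0) ->
  b m != 0 -> (forall n, (n < m)%N -> b n = 0) -> forall n, a n = 0.
Proof.
move=> ab0 bm bn0 n; elim/ltn_ind: n => n IH.
have := ab0 (n + m)%N; rewrite /cauchy_prod.
have nm : (n < (n + m).+1)%N by rewrite ltnS leq_addr.
rewrite (bigD1 (Ordinal nm)) //= addKn big1 ?addr0 => [/eqP|i iN].
  by rewrite mulf_eq0 (negbTE bm) orbF => /eqP.
have [/IH->|ni|ni] := ltngtP i n; first by rewrite mul0r.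
  by rewrite bn0 ?mulr0 // ltn_subLR ?ltn_add2r // -ltnS.
by move: iN; rewrite -val_eqE /= ni eqxx.
Qed.

End CauchyProduct.

(** * Products in Hardy spaces, and nonvanishing of [u] *)

Section Hardy.
Variable R : realType.
Local Notation C := R[i].
Local Notation mu := (circ R).
Implicit Types (U V : C -> C) (f g h u v : R -> C).

Lemma cvgC_mul (T : Type) (F : set_system T) {FF : Filter F} (f g : T -> C) (l m : C) :
  f @ F --> (l : C^o) -> g @ F --> (m : C^o) -> f \* g @ F --> (l * m : C^o).
Proof.
move=> /cvgC_ReIm[f1 f2] /cvgC_ReIm[g1 g2]; apply/cvgC_ReIm; rewrite ReM ImM /=; split.
  by under eq_fun do rewrite ReM; apply: cvgB; exact: cvgM.
by under eq_fun do rewrite ImM; apply: cvgD; exact: cvgM.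
Qed.

Lemma boundary_values_mul U V f g : boundary_values U f -> boundary_values V g ->
  boundary_values (fun z => U z * V z) (f \* g).
Proof. by apply: ae_circS2 => t Ut Vt; exact: (cvgC_mul Ut Vt). Qed.

Lemma boundary_values_cst U f (c : C) : (forall z, `|z| < 1 -> U z = c) ->
  boundary_values U f -> {ae mu, forall t, f t = c}.
Proof.
move=> Uc bU; apply: ae_circS bU => t Ut.
have cf : U ((radius R n)%:C * expi t) @[n --> \oo] --> (f t : C^o).
  exact: (cvg_comp _ _ (@cvg_radius_left R) Ut).
apply: (cvgC_unique cf); rewrite (_ : (fun n => _) = fun=> c).
  exact: (@cvg_cst C^o).
apply/funext => n; apply: Uc; rewrite cmod_lt cmod_radial.
by have /andP[r0 r1] := radius01 R n; rewrite ger0_norm.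
Qed.

Lemma hardyoo_hardy2 V : hardyoo_disc V -> hardy2_disc V.
Proof.
move=> [aV [M hM]]; apply/hardy2_discP; split => //; have [a ha] := aV.
exists M; split => [|r r01]; first by rewrite (le_trans (cmod_ge0 (V 0))) // hM // normr0.
have [r0 r1] := andP r01; apply: integral_cmod2_le; first exact: cmeasurable_radial ha r01.
by move=> t; apply: hM; rewrite cmod_lt cmod_radial ger0_norm.
Qed.

(** Analyticity is supplied by the Cauchy product; on each circle the norm grows at most by the
    factor [K]. *)
Lemma hardy2_disc_mul V U : hardyoo_disc V -> hardy2_disc U ->
  hardy2_disc (fun z => V z * U z).
Proof.
move=> [[b hb] [K hK]] /hardy2_discP[[a ha] [M [M0 hM]]].
have ba := has_series_mul hb ha.
have K0 : 0 <= K by rewrite (le_trans (cmod_ge0 (V 0))) // hK // normr0.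
apply/hardy2_discP; split; first by exists (cauchy_prod b a).
exists (K * M); split => [|r r01]; first exact: mulr_ge0.
have [r0 r1] := andP r01.
have mU := measurable_cmod2 (cmeasurable_radial ha r01).
rewrite exprMn EFinM; apply: le_trans (lee_wpmul2l _ (hM r r01)); last first.
  by rewrite lee_fin sqr_ge0.
rewrite -ge0_integralZl //; last 2 first.
- by move=> t _; rewrite lee_fin sqr_ge0.
- by rewrite lee_fin sqr_ge0.
apply: ge0_le_integral => //.
- by move=> t _; rewrite lee_fin sqr_ge0.
- by apply: measurable_cmod2; exact: cmeasurable_radial ba r01.
- exact: measurable_funeM.
- move=> t _; rewrite lee_fin cmodM exprMn ler_wpM2r ?sqr_ge0 //.
  rewrite lerXn2r ?nnegrE ?cmod_ge0 //.
  by apply: hK; rewrite cmod_lt cmod_radial ger0_norm.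
Qed.

Lemma mul_Hoo_H2 v f : Hoo v -> H2 f -> H2 (v \* f).
Proof.
move=> [/LpooP[mv bv] [V hV Vv]] [/Lp2P fi [U hU Uf]]; split.
  by apply/Lp2P; exact: sqintegrableM.
exists (fun z => V z * U z); first exact: hardy2_disc_mul.
exact: boundary_values_mul.
Qed.

Lemma has_series_monomial n : has_series (fun k => (k == n)%:R) (fun z : C => z ^+ n).
Proof.
move=> z _; apply/cvgC_cmod/cvgrPdist_lt => e e0; exists n.+1 => // N /= nN.
rewrite /series /= big_mkord (bigD1 (Ordinal nN)) //= eqxx mul1r big1 => [|i iN].
  by rewrite addr0 subrr cmod0 subr0 normr0.
by rewrite (_ : (i : nat) == n = false) ?mul0r //; exact: negbTE.
Qed.

(** Through [mul_Hoo_H2] this makes [u z^n] an admissible test function for the kernel of [T_F]. *)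
Lemma Hoo_expiX n : Hoo (fun t : R => expi t ^+ n).
Proof.
split.
  apply/LpooP; split; first exact: cmeasurable_expiX.
  by exists 1; apply: aeW => t; rewrite cmodX cmod_expi expr1n.
exists (fun z => z ^+ n).
  split; first by exists (fun k => (k == n)%:R); exact: has_series_monomial.
  exists 1 => z; rewrite cmod_lt => z1.
  by rewrite cmodX exprn_ile1 ?cmod_ge0 // ltW.
apply: aeW => t; apply/cvgC_cmod.
have : `|r ^+ n - 1| @[r --> (1 : R)^'-] --> 0.
  apply/norm_cvg0P; rewrite -[0 in X in _ --> X](subrr 1); apply: cvgB; last exact: cvg_cst.
  apply: cvg_at_left_filter.
  by have := @exprn_continuous R n 1; rewrite /continuous_at expr1n.
apply: cvg_trans; apply: near_eq_cvg; apply: nearW => r.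
have -> : (r%:C * expi t) ^+ n - expi t ^+ n = (r%:C ^+ n - 1) * expi t ^+ n.
  by rewrite exprMn mulrBl mul1r.
rewrite cmodM cmodX cmod_expi expr1n mulr1.
by rewrite -rmorphXn -(rmorph1 (real_complex R)) -rmorphB cmod_real.
Qed.

Lemma cmodV (z : C) : cmod z^-1 = (cmod z)^-1.
Proof. by apply: complexI; rewrite fmorphV /= -!normC_cmod normfV. Qed.

(** A unimodular constant times an exponential; this will exclude that [u] is zero a.e. *)
Lemma outer_disc_neq0 U : outer_disc U -> U 0 != 0.
Proof.
move=> [alpha [phi [a1 _ _ _ ->]]]; last by rewrite normr0.
apply: mulf_neq0; first by rewrite -normr_eq0 a1 oner_neq0.
rewrite -cmod_eq0 /cexp cmodM cmod_real cmod_expi mulr1 normr_eq0.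
by rewrite gt_eqF // expR_gt0.
Qed.

(* With [0^-1 = 0], the boundary values of [V U V] are those of [V] also where
   [u] vanishes, so that the series [a], [b] of [U], [V] satisfy [b a b = b]. *)
Lemma outer_inv_neq0 u : sqintegrable u -> outer u -> Hoo (fun t => (u t)^-1) ->
  {ae mu, forall t, u t != 0}.
Proof.
move=> ui [U [hU Uu oU]] [/LpooP[mv bv] [V hV Vv]].
have [[a ha] _] := hU; have [[b hb] _] := hV.
have vi : sqintegrable (fun t => (u t)^-1).
  have := sqintegrableM mv bv (sqintegrable_cst (1 : C)).
  by congr sqintegrable; apply/funext => t /=; rewrite mulr1.
have ba := has_series_mul hb ha; have bab := has_series_mul ba hb.
have hVUV : hardy2_disc (fun z => V z * U z * V z).
  by under eq_fun do rewrite mulrC; apply: hardy2_disc_mul => //; exact: hardy2_disc_mul.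
have bVU := boundary_values_mul Vv Uu.
have E n : cauchy_prod (cauchy_prod b a) b n = b n.
  rewrite -(hardy2_coefficient n hb (hardyoo_hardy2 hV) Vv vi).
  have vE : ((fun t => (u t)^-1) \* u) \* (fun t => (u t)^-1) = (fun t => (u t)^-1).
    apply/funext => t /=; have [->|u0] := eqVneq (u t) 0; first by rewrite invr0 mulr0.
    by rewrite mulVf // mul1r.
  have := boundary_values_mul bVU Vv; rewrite vE => bVUV.
  by rewrite -(hardy2_coefficient n bab hVUV bVUV vi).
(* If [b] is nonzero, it cancels from [(b a - 1) b = 0], so [V U = 1] on the disc and hence a.e. on
   the circle. *)
have [[m bm]|b0] := pselect (exists m, b m != 0).
  have [{bm}m bm mmin] := ex_minnP (ex_intro (fun m => b m != 0) m bm).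
  have d0 n : cauchy_prod b a n - (n == 0%N)%:R = 0.
    apply: (@cauchy_prod_eq0 _ (fun n => cauchy_prod b a n - (n == 0%N)%:R) b m) => // [N|N Nm].
      rewrite {1}/cauchy_prod; under eq_bigr do rewrite mulrBl.
      rewrite sumrB -/(cauchy_prod (cauchy_prod b a) b N) E big_ord_recl mul1r subn0.
      by rewrite big1 ?addr0 ?subrr // => i _; rewrite mul0r.
    by apply/eqP/negPn/negP => /mmin; rewrite leqNgt Nm.
  have VU1 z : `|z| < 1 -> V z * U z = 1.
    move=> z1; apply: (cvgC_unique (ba z z1)).
    rewrite (_ : (fun k => _) = (fun k => (k == 0%N)%:R * z ^+ k)).
      by have := @has_series_monomial 0 z z1; rewrite expr0.
    by apply/funext => k; rewrite -(subrK (k == 0%N)%:R (cauchy_prod b a k)) d0 add0r.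
  apply: ae_circS (boundary_values_cst VU1 bVU) => t /= vu1; apply/eqP => ut0.
  by move: vu1; rewrite ut0 mulr0 => /esym/eqP; rewrite oner_eq0.
(* If [b = 0], then [u^-1] is zero a.e., hence so is [u], as only 0 has inverse 0. This forces
   [a 0 = 0], against [U 0 != 0]. *)
exfalso; have V0 z : `|z| < 1 -> V z = 0.
  move=> z1; apply: (cvgC_unique (hb z z1)).
  rewrite (_ : series _ = fun=> 0); first exact: (@cvg_cst C^o).
  apply/funext => N; rewrite /series /= big1 // => k _.
  by have [->|bk] := eqVneq (b k) 0; rewrite ?mul0r //; case: b0; exists k.
have u0 : aeq u (fun=> 0).
  apply: ae_circS (boundary_values_cst V0 Vv) => t vt _.
  by apply/eqP; rewrite -invr_eq0; exact/eqP.
have a0 : a 0%N = 0.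
  have <- : inner (fun=> 0) (fun t : R => expi t ^+ 0) = 0 :> C.
    by rewrite /inner; under eq_fun do rewrite mul0r; exact: cintegral0.
  rewrite -(hardy2_coefficient 0 ha hU Uu ui).
  have [mu' _] := ui; apply: inner_ae => //; do ?exact: cmeasurable_cst.
  by apply: ae_circS u0 => t + Dt => ->.
have /negP[] := outer_disc_neq0 oU; apply/eqP.
have z0 : `|0 : C| < 1 by rewrite normr0.
apply: (cvgC_unique (ha 0 z0)); apply/cvgC_cmod/cvgrPdist_lt => e e0; exists 1%N => // N /= N0.
rewrite subr0 /series /= big1 ?cmod0 ?subr0 ?normr0 // => -[|k] _; first by rewrite a0 mul0r.
by rewrite expr0n mulr0.
Qed.

End Hardy.

(** * Toeplitz kernels and the theorem *)

Section ToeplitzKernel.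
Variable R : realType.
Local Notation C := R[i].
Implicit Types (f g : R -> C).

(** Being projected to 0 means being orthogonal to H^2. Membership of the zero function in H^2 stays
    in the list, and each inclusion below inherits it from the kernel it starts with. *)
Lemma kerTP g f : kerT g f <->
  [/\ Lp +oo%E g, H2 f, H2 (fun=> 0 : C) & forall h, H2 h -> inner (g \* f) h = 0].
Proof.
have gf0 : (g \* f) \- (fun=> 0) = g \* f by apply/funext => t /=; rewrite subr0.
split => [[? ? [? +]]|[? ? ? ?]]; first by rewrite gf0.
by split => //; split => //; rewrite gf0.
Qed.

Lemma H2_sqintegrable f : H2 f -> sqintegrable f.
Proof. by case=> /Lp2P. Qed.

Lemma inner_eq0C f g : sqintegrable f -> sqintegrable g -> inner f g = 0 -> inner g f = 0.
Proof. by move=> fi gi fg0; rewrite innerC // fg0 rmorph0. Qed.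

Lemma Lpoo_mul f g : Lp +oo%E f -> Lp +oo%E g -> Lp +oo%E (f \* g).
Proof.
move=> /LpooP[mf [A fA]] /LpooP[mg [B gB]]; apply/LpooP; split; first exact: cmeasurableM.
exists (A * B); apply: ae_circS2 fA gB => t At Bt.
by rewrite cmodM ler_pM ?cmod_ge0.
Qed.

Lemma Lpoo_mul_sqintegrable g f : Lp +oo%E g -> sqintegrable f -> sqintegrable (g \* f).
Proof. by move=> /LpooP[mg bg]; exact: sqintegrableM. Qed.

End ToeplitzKernel.

Unset Implicit Arguments.

Theorem proposition3p4 (R : realType) (F u : R -> R[i])
  (hF : Lp +oo%E F) (hF0 : ~ aeq F (fun=> 0))
  (hu : H2 u) (hout : outer u)
  (hker : exists2 f, kerT F f & ~ aeq f (fun=> 0))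
  (hmul : mul_set u (kerT F) `<=` @H2 R)
  (hinv : Hoo (fun t => (u t)^-1)) :
  mul_set u (kerT F) = kerT (fun t => F t * (u t)^* / u t) /\
  kerT (fun t => F t * (u t)^* / u t) = kerT (fun t => F t / u t).
Proof.
set G1 := fun t => F t * (u t)^* / u t; set G2 := fun t => F t / u t.
have ui := H2_sqintegrable hu; have [mes_u _] := ui.
have u0 := outer_inv_neq0 ui hout hinv.
have /LpooP[mF _] := hF.
have hv := hinv.1; have /LpooP[mv _] := hv.
have hG2 : Lp +oo%E G2 by exact: Lpoo_mul.
have hG1 : Lp +oo%E G1.
  have -> : G1 = F \* (fun t => (u t)^* / u t) by apply/funext => t; rewrite /G1 -mulrA.
  apply: Lpoo_mul => //; apply/LpooP; split.
    exact: (cmeasurableM (cmeasurableJ mes_u) mv).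
  (* The quotient has modulus 1 where [u] is nonzero and is 0 elsewhere, by [0^-1 = 0]. *)
  exists 1; apply: aeW => t; rewrite cmodM cmodJ cmodV.
  by have [->|c0] := eqVneq (cmod (u t)) 0; rewrite ?mul0r ?ler01 // divff.
have mG1 : cmeasurable G1 by case/LpooP: hG1.
have mG2 : cmeasurable G2 by case/LpooP: hG2.
have mH (f : R -> R[i]) : H2 f -> cmeasurable f by move=> /H2_sqintegrable[].
have mulF1 : mul_set u (kerT F) `<=` kerT G1.
  move=> g ug; have hg := hmul _ ug; case: ug => mg [f /kerTP[_ hf H0 Ff] guf].
  apply/kerTP; split => // h hh.
  have ki := Lpoo_mul_sqintegrable hG1 (H2_sqintegrable hg).
  have [_ [U hU Uh]] := hh; have hi := H2_sqintegrable hh.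
  (* [hardy2_orthogonal] has the Hardy function as first argument of the pairing, hence the
     conjugations here and for the monomial. *)
  apply: inner_eq0C => //; apply: (hardy2_orthogonal hU Uh hi ki) => n.
  have ei := sqintegrable_expiX R n; apply: inner_eq0C => //.
  rewrite -(Ff _ (mul_Hoo_H2 (Hoo_expiX R n) hu)); apply: inner_ae.
  - exact: ki.1.
  - exact: (cmeasurableM mF (mH _ hf)).
  - exact: ei.1.
  - exact: (cmeasurableM ei.1 mes_u).
  - apply: ae_circS2 u0 guf => t ut0 /(_ I) gt _ /=.
    rewrite gt /G1 /= rmorphM /=; field.
    exact: ut0.
have mulF2 : mul_set u (kerT F) `<=` kerT G2.
  move=> g ug; have hg := hmul _ ug; case: ug => mg [f /kerTP[_ hf H0 Ff] guf].
  apply/kerTP; split => // h hh; rewrite -(Ff h hh); apply: inner_ae.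
  - exact: (cmeasurableM mG2 (mH _ hg)).
  - exact: (cmeasurableM mF (mH _ hf)).
  - exact: (mH _ hh).
  - exact: (mH _ hh).
  - apply: ae_circS2 u0 guf => t ut0 /(_ I) gt _ /=.
    by rewrite gt /G2 /=; field.
(* [g] is recovered as [u (u^-1 g)] a.e., where [u] is nonzero, and [mul_set] asks for equality a.e.
   only. *)
have kerF_mul (g : R -> R[i]) : kerT F ((fun t => (u t)^-1) \* g) -> H2 g -> mul_set u (kerT F) g.
  move=> vg hg; split; first exact: mH.
  exists ((fun t => (u t)^-1) \* g) => //; apply: ae_circS u0 => t ut0 _ /=.
  by rewrite mulrA divff // mul1r.
have mul1F : kerT G1 `<=` mul_set u (kerT F).
  move=> g /kerTP[_ hg H0 Gg]; apply: (kerF_mul _ _ hg); apply/kerTP.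
  have hvg := mul_Hoo_H2 hinv hg; split; [exact: hF|exact: hvg|exact: H0|move=> h hh].
  have hvh := mul_Hoo_H2 hinv hh.
  rewrite -(Gg _ hvh); apply: inner_ae.
  - exact: (cmeasurableM mF (mH _ hvg)).
  - exact: (cmeasurableM mG1 (mH _ hg)).
  - exact: (mH _ hh).
  - exact: (mH _ hvh).
  - apply: ae_circS u0 => t ut0 _ /=.
    have c0 : (u t)^* != 0 by rewrite conjc_eq0.
    have -> : ((u t)^-1 * h t)^* = ((u t)^*)^-1 * (h t)^*.
      by rewrite rmorphM; congr (_ * _); exact: conjc_inv.
    rewrite /G1; field.
    by rewrite ut0 c0.
have mul2F : kerT G2 `<=` mul_set u (kerT F).
  move=> g /kerTP[_ hg H0 Gg]; apply: (kerF_mul _ _ hg); apply/kerTP.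
  have hvg := mul_Hoo_H2 hinv hg; split; [exact: hF|exact: hvg|exact: H0|move=> h hh].
  (* The two products agree at every point, by associativity. *)
  rewrite -(Gg h hh); congr inner; apply/funext => t /=.
  by rewrite /G2 -mulrA.
have E1 : mul_set u (kerT F) = kerT G1 by apply/seteqP.
by split => //; rewrite -E1; apply/seteqP.
Qed.
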